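(* Let $p\ge 3$ and $\lambda>0$. There exists a periodic sign-changing solution $u$ of $$u''-uu'+u|u|^{p-1}-\lambda u=0\quad\text{in }\mathbb{R}.$$
   Context: A solution is a real-valued function of class $\mathcal{C}^2$ satisfying the equation in the classical sense. It is sign-changing if it takes both positive and negative values. *)

(* Defs.v *)
From Stdlib Require Import Reals.
From Coquelicot Require Import Coquelicot.
Open Scope R_scope.

(* |a|^q for a real exponent q > 0.  The case a = 0 is separate because
   Rpower is exp (q * ln a) and takes the value 1 at a = 0. *)
Definition abs_pow (a q : R) : R :=
  if Req_dec_T a 0 then 0 else Rpower (Rabs a) q.

Definition C2 (u : R -> R) : Prop :=
  forall x, ex_derive u x /\ ex_derive (Derive u) x
            /\ continuous (Derive (Derive u)) x.

Definition is_solution (p lambda : R) (u : R -> R) : Prop :=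
  C2 u /\
  forall x, Derive (Derive u) x - u x * Derive u x
            + u x * abs_pow (u x) (p - 1) - lambda * u x = 0.

Definition sign_changing (u : R -> R) : Prop :=
  (exists x, 0 < u x) /\ (exists x, u x < 0).

Definition periodic (u : R -> R) : Prop :=
  exists T, 0 < T /\ forall x, u (x + T) = u x.

(* Main.v *)
Require Import Defs.
From Stdlib Require Import Reals Lra Lia Classical.
From Coquelicot Require Import Coquelicot.
Open Scope R_scope.

(** In the Lienard form [u' = y + u^2/2], [y' = - g u], with
    [g u = u |u|^(p-1) - lambda u], the equation is invariant under
    [(t, u, y) -> (-t, -u, y)].  Hence the solution with [u 0 = 0], [y 0 = 1] has
    [u] odd and [y] even, and if [u T = 0] with [T > 0] then uniqueness makes it
    [2T]-periodic.

    Such a [T] exists.  Put [w = u'].  While [u >= 0] the energy [w^2/2 + G u],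
    with [G' = g], does not decrease, so it stays [>= 1/2]; thus [w] can vanish
    only where [G u > 0], hence [g u > 0] and [w' < 0], so [w] changes sign at
    most once.  While [w >= 0], a Lyapunov function bounds [u]: since
    [p - 1 >= 2], in the variable [z = u^2/2] the motion is dominated by the
    linear one [z'' - z' + 2 z = const], whose characteristic roots are not real.
    Finally the bounded orbit cannot remain in [u > 0] for ever.  As the bound is
    known beforehand, the field is truncated to a globally Lipschitz one from
    the start. *)

(** * Monotonicity, derivatives and exponential bounds *)

Lemma nondecreasing_of_derive (f df : R -> R) (a b : R) :
  a <= b ->
  (forall x, a <= x <= b -> is_derive f x (df x)) ->
  (forall x, a <= x <= b -> 0 <= df x) ->
  f a <= f b.
Proof.
  intros hab hf hdf.
  destruct (MVT_gen f a b df) as [c [hc e]].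
  - rewrite Rmin_left, Rmax_right by lra. intros x hx. apply hf. lra.
  - rewrite Rmin_left, Rmax_right by lra. intros x hx.
    apply continuity_pt_filterlim.
    apply (ex_derive_continuous (K := R_AbsRing) (V := R_NormedModule)).
    exists (df x). now apply hf.
  - rewrite Rmin_left, Rmax_right in hc by lra.
    specialize (hdf c hc). nra.
Qed.

Lemma is_derive_eq (f : R -> R) (x d d' : R) :
  is_derive f x d -> d = d' -> is_derive f x d'.
Proof. intros hf <-. exact hf. Qed.

Lemma is_derive_continuous (f : R -> R) (x d : R) :
  is_derive f x d -> continuous f x.
Proof.
  intro hf. apply (ex_derive_continuous (K := R_AbsRing) (V := R_NormedModule)).
  now exists d.
Qed.

Lemma is_derive_reflect (f : R -> R) (x d : R) :
  is_derive f (- x) d -> is_derive (fun s => f (- s)) x (- d).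
Proof.
  intro hf. eapply is_derive_eq.
  - apply (is_derive_comp f Ropp x d (-1)); [exact hf |].
    auto_derive; [trivial | lra].
  - unfold scal; simpl; unfold mult; simpl. lra.
Qed.

Lemma is_derive_RInt_0 (f : R -> R) :
  (forall x, continuous f x) ->
  forall x, is_derive (fun t => RInt f 0 t) x (f x).
Proof.
  intros hf x. apply (is_derive_RInt f _ 0 x); [| apply hf].
  apply filter_forall. intro t.
  apply (RInt_correct (V := R_CompleteNormedModule)), ex_RInt_continuous. auto.
Qed.

Lemma RInt_0_0 (f : R -> R) : RInt f 0 0 = 0.
Proof. exact (RInt_point 0 f). Qed.

Lemma le_exp_of_derive_le (f df : R -> R) (K a t : R) :
  0 < a -> 0 <= t -> 0 <= K -> f 0 = 0 ->
  (forall s, is_derive f s (df s)) ->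
  (forall s, 0 <= s -> df s <= K * exp (a * s)) ->
  f t <= K / a * exp (a * t).
Proof.
  intros ha ht hK h0 hf hdf.
  assert (K / a * exp (a * 0) - f 0 <= K / a * exp (a * t) - f t) as h.
  { apply (nondecreasing_of_derive (fun s => K / a * exp (a * s) - f s)
             (fun s => K * exp (a * s) - df s)); [lra | |].
    - intros s _. apply (is_derive_minus (fun s => K / a * exp (a * s)) f); [| apply hf].
      auto_derive; [trivial | field; lra].
    - intros s hs. specialize (hdf s). lra. }
  rewrite Rmult_0_r, exp_0, h0 in h.
  assert (0 <= K / a) by (apply Rdiv_le_0_compat; lra). lra.
Qed.

(** Integration from 0 gains a factor [1 / a] in the norm weighted by [exp (a * |t|)], so a large
    [a] makes an integral operator with Lipschitz integrand a contraction. Negative times follow by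
    reflection. *)
Lemma Rabs_le_exp_of_derive (f df : R -> R) (K a : R) :
  0 < a -> f 0 = 0 ->
  (forall s, is_derive f s (df s)) ->
  (forall s, Rabs (df s) <= K * exp (a * Rabs s)) ->
  forall t, Rabs (f t) <= K / a * exp (a * Rabs t).
Proof.
  intros ha h0 hf hdf.
  assert (0 <= K) as hK.
  { specialize (hdf 0). rewrite Rabs_R0, Rmult_0_r, exp_0 in hdf.
    pose proof (Rabs_pos (df 0)). lra. }
  assert (forall (g dg : R -> R), g 0 = 0 -> (forall s, is_derive g s (dg s)) ->
          (forall s, Rabs (dg s) <= K * exp (a * Rabs s)) ->
          forall t, 0 <= t -> Rabs (g t) <= K / a * exp (a * t)) as half.
  { intros g dg hg0 hg hdg t ht. apply Rabs_le. split.
    - assert (- g t <= K / a * exp (a * t)); [| lra].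
      apply (le_exp_of_derive_le (fun s => - g s) (fun s => - dg s)); try lra.
      + intro s. now apply (is_derive_opp g).
      + intros s hs. specialize (hdg s). rewrite (Rabs_pos_eq s hs) in hdg.
        pose proof (Rcomplements.Rabs_maj2 (dg s)). lra.
    - apply (le_exp_of_derive_le g dg); try lra; [exact hg |].
      intros s hs. specialize (hdg s). rewrite (Rabs_pos_eq s hs) in hdg.
      pose proof (Rle_abs (dg s)). lra. }
  intro t. destruct (Rle_dec 0 t) as [ht | ht].
  - rewrite (Rabs_pos_eq t ht). now apply (half f df).
  - rewrite (Rabs_left t) by lra.
    replace (f t) with (f (- - t)) by (f_equal; lra).
    apply (half (fun s => f (- s)) (fun s => - df (- s))); try lra.
    + now rewrite Ropp_0.
    + intro s. apply is_derive_reflect, hf.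
    + intro s. rewrite Rabs_Ropp, <- (Rabs_Ropp s). apply hdf.
Qed.

(** * A fixed point theorem in a weighted norm *)

Lemma continuous_eps (f : R -> R) (x : R) :
  continuous f x <->
  forall eps, 0 < eps -> exists d, 0 < d /\
    forall y, Rabs (y - x) < d -> Rabs (f y - f x) < eps.
Proof.
  split.
  - intros hf eps he.
    destruct (proj1 (filterlim_locally _ _) hf (mkposreal eps he)) as [d hd].
    exists d. split; [apply cond_pos | exact hd].
  - intro h. apply filterlim_locally. intro eps.
    destruct (h eps (cond_pos eps)) as [d [hd hy]].
    exists (mkposreal d hd). exact hy.
Qed.

Lemma exp_le (x y : R) : x <= y -> exp x <= exp y.
Proof. intros [h | ->]; [left; now apply exp_increasing | right; reflexivity]. Qed.

Lemma le_of_le_geometric (a b C : R) :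
  (forall n : nat, a <= b + C * (/ 2) ^ n) -> a <= b.
Proof.
  intro h. destruct (Rle_dec a b) as [| hn]; [assumption | exfalso].
  assert (0 <= C) as hC.
  { specialize (h O). simpl in h. lra. }
  destruct (pow_lt_1_zero (/ 2)) with (y := (a - b) / (C + 1)) as [N hN].
  - rewrite Rabs_pos_eq; lra.
  - apply Rdiv_lt_0_compat; lra.
  - specialize (hN N (le_n _)). specialize (h N).
    rewrite Rabs_pos_eq in hN by (apply pow_le; lra).
    apply Rlt_div_r in hN; [| lra].
    assert (0 <= (/ 2) ^ N) by (apply pow_le; lra). nra.
Qed.

(* Banach's fixed point theorem for the norm [sup |u t| * exp (- a * |t|)]. *)
Lemma weighted_fixed_point (Phi : (R -> R) -> (R -> R)) (a A : R) :
  0 <= a ->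
  (forall u, (forall x, continuous u x) -> forall x, continuous (Phi u) x) ->
  (forall u v K, (forall x, continuous u x) -> (forall x, continuous v x) ->
    (forall t, Rabs (u t - v t) <= K * exp (a * Rabs t)) ->
    forall t, Rabs (Phi u t - Phi v t) <= K / 2 * exp (a * Rabs t)) ->
  (forall t, Rabs (Phi (fun _ => 0) t) <= A * exp (a * Rabs t)) ->
  exists u, (forall x, continuous u x) /\ forall t, Phi u t = u t.
Proof.
  intros ha hcont hS h0.
  set (phi := fun n => Nat.iter n Phi (fun _ => 0)).
  assert (forall n x, continuous (phi n) x) as hphi.
  { induction n; [intro; apply continuous_const | exact (hcont _ IHn)]. }
  set (W := fun t => A * exp (a * Rabs t)).
  assert (forall t, 0 <= W t) as hW.
  { intro t. eapply Rle_trans; [apply Rabs_pos | apply h0]. }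
  assert (forall n t, Rabs (phi (S n) t - phi n t) <= W t * (/ 2) ^ n) as hstep.
  { assert (forall n t, Rabs (phi (S n) t - phi n t) <= A * (/ 2) ^ n * exp (a * Rabs t)) as h.
    { induction n; intro t.
      - simpl. rewrite Rminus_0_r, Rmult_1_r. apply h0.
      - replace (A * (/ 2) ^ (S n)) with (A * (/ 2) ^ n / 2) by (simpl; field).
        apply (hS (phi (S n)) (phi n)); auto. }
    intros n t. unfold W. specialize (h n t). lra. }
  (* The exact geometric sum, with its factor [1 - 2^-k], is kept so that the induction on [k]
     closes. *)
  assert (forall n k t, Rabs (phi (n + k)%nat t - phi n t)
                        <= 2 * W t * (/ 2) ^ n * (1 - (/ 2) ^ k)) as htel.
  { intros n k t. induction k.
    - rewrite Nat.add_0_r, Rminus_diag, Rabs_R0. simpl. lra.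
    - rewrite Nat.add_succ_r. specialize (hstep (n + k)%nat t).
      replace (phi (S (n + k)) t - phi n t)
        with ((phi (S (n + k)) t - phi (n + k)%nat t) + (phi (n + k)%nat t - phi n t)) by lra.
      eapply Rle_trans; [apply Rabs_triang |].
      rewrite pow_add in hstep. rewrite <- tech_pow_Rmult.  lra. }
  assert (forall n k t, Rabs (phi (n + k)%nat t - phi n t) <= 2 * W t * (/ 2) ^ n) as hcau.
  { intros n k t. eapply Rle_trans; [apply htel |].
    assert (0 <= (/ 2) ^ k) by (apply pow_le; lra).
    assert (0 <= W t * (/ 2) ^ n) by (apply Rmult_le_pos; [apply hW | apply pow_le; lra]).
    nra. }
  assert (forall t, { l | Un_cv (fun n => phi n t) l }) as hlim.
  { intro t. apply Rcomplete.R_complete. intros eps he.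
    destruct (pow_lt_1_zero (/ 2)) with (y := eps / (4 * W t + 1)) as [N hN].
    - rewrite Rabs_pos_eq; lra.
    - specialize (hW t). apply Rdiv_lt_0_compat; lra.
    - exists N. specialize (hN N (le_n _)). specialize (hW t).
      rewrite Rabs_pos_eq in hN by (apply pow_le; lra).
      apply Rlt_div_r in hN; [| lra].
      assert (0 <= (/ 2) ^ N) by (apply pow_le; lra).
      intros n m hn hm. unfold Rdist.
      replace n with (N + (n - N))%nat by lia. replace m with (N + (m - N))%nat by lia.
      pose proof (hcau N (n - N)%nat t) as h1. pose proof (hcau N (m - N)%nat t) as h2.
      revert h1 h2. generalize (phi (N + (n - N))%nat t) (phi (N + (m - N))%nat t).
      intros p q h1 h2. rewrite Rabs_minus_sym in h2.
      replace (p - q) with ((p - phi N t) + (phi N t - q)) by lra.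
      eapply Rle_lt_trans; [apply Rabs_triang |]. nra. }
  set (u := fun t => proj1_sig (hlim t)).
  assert (forall n t, Rabs (u t - phi n t) <= 2 * W t * (/ 2) ^ n) as hu.
  { intros n t. apply le_epsilon. intros eps he. unfold u.
    destruct (hlim t) as [l hl]; simpl. destruct (hl eps he) as [N hN].
    specialize (hN (n + N)%nat ltac:(lia)). specialize (hcau n N t).
    unfold Rdist in hN. rewrite Rabs_minus_sym in hN.
    replace (l - phi n t) with ((l - phi (n + N)%nat t) + (phi (n + N)%nat t - phi n t)) by lra.
    eapply Rle_trans; [apply Rabs_triang |]. lra. }
  assert (forall x, continuous u x) as hucont.
  { intro x. apply continuous_eps. intros eps he.
    (* [B] dominates [2 * W y] for all [y] within distance 1 of [x]: convergence is locally uniform,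
       and continuity passes to the limit. *)
    set (B := 2 * (A * exp (a * (Rabs x + 1)))).
    assert (0 <= A) as hA.
    { specialize (hW 0). unfold W in hW. rewrite Rabs_R0, Rmult_0_r, exp_0 in hW. lra. }
    assert (0 <= B) as hB.
    { pose proof (exp_pos (a * (Rabs x + 1))). unfold B. nra. }
    assert (forall n y, Rabs (y - x) < 1 -> Rabs (u y - phi n y) <= B * (/ 2) ^ n) as hB'.
    { intros n y hy. eapply Rle_trans; [apply hu |].
      apply Rmult_le_compat_r; [apply pow_le; lra |].
      unfold B, W. apply Rmult_le_compat_l; [lra |]. apply Rmult_le_compat_l; [exact hA |].
      apply exp_le. apply Rmult_le_compat_l; [exact ha |].
      pose proof (Rabs_triang_inv y x). lra. }
    destruct (pow_lt_1_zero (/ 2)) with (y := eps / (3 * (B + 1))) as [N hN].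
    - rewrite Rabs_pos_eq; lra.
    - apply Rdiv_lt_0_compat; lra.
    - specialize (hN N (le_n _)).
      rewrite Rabs_pos_eq in hN by (apply pow_le; lra).
      apply Rlt_div_r in hN; [| lra].
      assert (0 <= (/ 2) ^ N) by (apply pow_le; lra).
      destruct (proj1 (continuous_eps _ _) (hphi N x) (eps / 3)) as [d [hd hdy]]; [lra |].
      exists (Rmin d 1). split; [apply Rmin_pos; lra |].
      intros y hy.
      pose proof (Rmin_l d 1). pose proof (Rmin_r d 1).
      specialize (hdy y ltac:(lra)).
      pose proof (hB' N y ltac:(lra)) as h1.
      assert (Rabs (u x - phi N x) <= B * (/ 2) ^ N) as h2.
      { apply hB'. rewrite Rminus_diag, Rabs_R0. lra. }
      rewrite Rabs_minus_sym in h2.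
      replace (u y - u x) with ((u y - phi N y) + ((phi N y - phi N x) + (phi N x - u x))) by lra.
      eapply Rle_lt_trans; [apply Rabs_triang |].
      pose proof (Rabs_triang (phi N y - phi N x) (phi N x - u x)). nra. }
  exists u. split; [exact hucont |].
  intro t. apply Rminus_diag_uniq, Rabs_eq_0. apply Rle_antisym; [| apply Rabs_pos].
  (* [Phi u] and [u] both lie within [W t * 2^-n] of [phi (S n)]. *)
  apply (le_of_le_geometric _ _ (2 * W t)). intro n.
  pose proof (hu (S n) t) as h1.
  assert (Rabs (Phi u t - Phi (phi n) t) <= 2 * A * (/ 2) ^ n / 2 * exp (a * Rabs t)) as h2.
  { apply hS; auto. intro s. specialize (hu n s). unfold W in hu. lra. }
  change (Phi (phi n) t) with (phi (S n) t) in h2. rewrite Rabs_minus_sym in h1.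
  replace (Phi u t - u t) with ((Phi u t - phi (S n) t) + (phi (S n) t - u t)) by lra.
  eapply Rle_trans; [apply Rabs_triang |].
  rewrite <- tech_pow_Rmult in h1. unfold W in *. lra.
Qed.

(** * Existence and uniqueness for Lipschitz Lienard systems *)

Definition lipschitz (L : R) (f : R -> R) : Prop :=
  forall a b, Rabs (f a - f b) <= L * Rabs (a - b).

Lemma lipschitz_continuous (L : R) (f : R -> R) :
  0 <= L -> lipschitz L f -> forall x, continuous f x.
Proof.
  intros hL hf x. apply continuous_eps. intros eps he.
  exists (eps / (L + 1)). split; [apply Rdiv_lt_0_compat; lra |].
  intros y hy. apply Rlt_div_r in hy; [| lra].
  specialize (hf y x). pose proof (Rabs_pos (y - x)). nra.
Qed.

(** Differentiating the first equation gives [u'' = h'(u) u' - g(u)], the equation of the theorem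
    when [h u = u^2/2]. In these variables truncating [u] alone makes the field globally Lipschitz;
    the product [u * u'] of the phase plane would not allow this. *)
Definition lienard (h g u y : R -> R) : Prop :=
  forall t, is_derive u t (y t + h (u t)) /\ is_derive y t (- g (u t)).

(** Picard iteration on one unknown: the second equation expresses [y] as an integral of [g u], and
    the first becomes a scalar integral equation for [u]. *)
Lemma lienard_exists (h g : R -> R) (L y0 : R) :
  0 <= L -> lipschitz L h -> lipschitz L g -> h 0 = 0 -> g 0 = 0 ->
  exists u y, u 0 = 0 /\ y 0 = y0 /\ lienard h g u y.
Proof.
  intros hL hh hg h0 g0.
  pose proof (lipschitz_continuous L h hL hh) as hhc.
  pose proof (lipschitz_continuous L g hL hg) as hgc.
  (* Since [a >= 1], [rhs] is [2 * L]-Lipschitz in the weighted norm; the outer integration divides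
     by [a], and [2 * L / a <= 1 / 2]. *)
  set (a := 4 * L + 1).
  set (rhs := fun (u : R -> R) s => y0 - RInt (fun r => g (u r)) 0 s + h (u s)).
  set (Phi := fun (u : R -> R) t => RInt (rhs u) 0 t).
  assert (forall (f u : R -> R), (forall x, continuous f x) -> (forall x, continuous u x) ->
            forall x, continuous (fun s => f (u s)) x) as hcomp.
  { intros f u hf hu x. apply (continuous_comp u f); auto. }
  assert (forall u, (forall x, continuous u x) ->
            forall x, is_derive (fun s => RInt (fun r => g (u r)) 0 s) x (g (u x))) as hJ.
  { intros u hu. apply (is_derive_RInt_0 (fun r => g (u r))). auto. }
  assert (forall u, (forall x, continuous u x) -> forall x, continuous (rhs u) x) as hrhs.
  { intros u hu x. unfold rhs.
    apply (continuous_plus (V := R_NormedModule)); [| auto].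
    apply (continuous_minus (V := R_NormedModule)); [apply continuous_const |].
    eapply is_derive_continuous. auto. }
  assert (forall u, (forall x, continuous u x) -> forall x, is_derive (Phi u) x (rhs u x)) as hPhi.
  { intros u hu. apply is_derive_RInt_0. auto. }
  destruct (weighted_fixed_point Phi a (Rabs y0 / a)) as [u [hu e]].
  - unfold a; lra.
  - intros u hu x. eapply is_derive_continuous. auto.
  - intros u v K hu hv huv t.
    assert (forall s, Rabs (rhs u s - rhs v s) <= 2 * L * K * exp (a * Rabs s)) as hr.
    { intro s.
      assert (forall f : R -> R, lipschitz L f -> forall r, Rabs (f (u r) - f (v r)) <= L * K * exp (a * Rabs r)) as hl.
      { intros f hf r. eapply Rle_trans; [apply hf |]. rewrite Rmult_assoc.
        apply Rmult_le_compat_l; auto. }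
      assert (Rabs (RInt (fun r => g (u r)) 0 s - RInt (fun r => g (v r)) 0 s)
              <= L * K / a * exp (a * Rabs s)) as h1.
      { apply (Rabs_le_exp_of_derive
                 (fun s => RInt (fun r => g (u r)) 0 s - RInt (fun r => g (v r)) 0 s)
                 (fun s => g (u s) - g (v s))).
        - unfold a; lra.
        - rewrite !RInt_0_0. lra.
        - intro r. apply (is_derive_minus (V := R_NormedModule)); auto.
        - auto. }
      pose proof (hl h hh s) as h2.
      assert (L * K / a * exp (a * Rabs s) <= L * K * exp (a * Rabs s)) as h3.
      { assert (0 <= L * K * exp (a * Rabs s)) by (eapply Rle_trans; [apply Rabs_pos | exact h2]).
        replace (L * K / a * exp (a * Rabs s)) with (L * K * exp (a * Rabs s) / a)
          by (unfold a; field; lra).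
        apply Rle_div_l; unfold a in *; nra. }
      unfold rhs. rewrite Rabs_minus_sym in h1.
      match goal with |- Rabs ?e <= _ => replace e with
        ((RInt (fun r => g (v r)) 0 s - RInt (fun r => g (u r)) 0 s) + (h (u s) - h (v s))) by lra end.
      eapply Rle_trans; [apply Rabs_triang |]. lra. }
    assert (Rabs (Phi u t - Phi v t) <= 2 * L * K / a * exp (a * Rabs t)) as h1.
    { apply (Rabs_le_exp_of_derive (fun t => Phi u t - Phi v t) (fun t => rhs u t - rhs v t)).
      - unfold a; lra.
      - unfold Phi. rewrite !RInt_0_0. lra.
      - intro r. apply (is_derive_minus (V := R_NormedModule)); auto.
      - exact hr. }
    eapply Rle_trans; [exact h1 |].
    assert (0 <= K * exp (a * Rabs t)) by (eapply Rle_trans; [apply Rabs_pos | apply huv]).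
    replace (2 * L * K / a * exp (a * Rabs t)) with (2 * L * (K * exp (a * Rabs t)) / a)
      by (unfold a; field; lra).
    apply Rle_div_l; unfold a in *; nra.
  - assert (forall x, continuous (fun _ : R => 0) x) as hc by (intro; apply continuous_const).
    apply (Rabs_le_exp_of_derive _ (rhs (fun _ => 0))).
    + unfold a; lra.
    + unfold Phi. apply RInt_0_0.
    + auto.
    + intro s. unfold rhs. rewrite RInt_const, g0, h0.
      match goal with |- Rabs ?e <= _ => replace e with y0 end;
        [| unfold scal; simpl; unfold mult; simpl; lra].
      assert (1 <= exp (a * Rabs s)).
      { rewrite <- exp_0. apply exp_le. apply Rmult_le_pos; [unfold a; lra | apply Rabs_pos]. }
      rewrite <- (Rmult_1_r (Rabs y0)) at 1.
      apply Rmult_le_compat_l; [apply Rabs_pos | assumption].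
  - exists u, (fun s => y0 - RInt (fun r => g (u r)) 0 s).
    split; [| split].
    + rewrite <- e. apply RInt_0_0.
    + rewrite RInt_0_0. lra.
    + intro t. split.
      * apply (is_derive_ext (Phi u)); [exact e |]. now apply hPhi.
      * eapply is_derive_eq.
        -- apply (is_derive_minus (V := R_NormedModule)); [apply is_derive_const | now apply hJ].
        -- unfold minus, plus, opp, zero; simpl. lra.
Qed.

(** For [t >= 0] the product [exp (- K * t) * Q t] cannot increase, so it stays at zero; reflection
    treats [t < 0]. *)
Lemma gronwall_zero (Q dQ : R -> R) (K : R) :
  Q 0 = 0 -> (forall t, 0 <= Q t) ->
  (forall t, is_derive Q t (dQ t)) ->
  (forall t, Rabs (dQ t) <= K * Q t) ->
  forall t, Q t = 0.
Proof.
  intros h0 hQ hd hK.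
  assert (forall (P dP : R -> R), P 0 = 0 -> (forall t, 0 <= P t) ->
    (forall t, is_derive P t (dP t)) -> (forall t, Rabs (dP t) <= K * P t) ->
    forall t, 0 <= t -> P t = 0) as half.
  { intros P dP hP0 hP hdP hKP t ht.
    apply Rle_antisym; [| apply hP].
    assert (- (exp (- K * 0) * P 0) <= - (exp (- K * t) * P t)) as h1.
    { apply (nondecreasing_of_derive (fun s => - (exp (- K * s) * P s))
               (fun s => exp (- K * s) * (K * P s - dP s))); [lra | |].
      - intros s _. auto_derive; [now exists (dP s) |].
        rewrite (is_derive_unique (fun x : R => P x) s (dP s)) by auto. ring.
      - intros s _. specialize (hKP s). pose proof (Rle_abs (dP s)).
        apply Rmult_le_pos; [left; apply exp_pos | lra]. }
    rewrite hP0 in h1. pose proof (exp_pos (- K * t)). specialize (hP t). nra. }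
  intro t. destruct (Rle_dec 0 t) as [ht | ht]; [now apply (half Q dQ) |].
  replace t with (- - t) by lra.
  apply (half (fun s => Q (- s)) (fun s => - dQ (- s))); try lra.
  - now rewrite Ropp_0.
  - intro s. auto.
  - intro s. apply is_derive_reflect, hd.
  - intro s. rewrite Rabs_Ropp. apply hK.
Qed.

(** Gronwall's argument for the squared distance of the two orbits. *)
Lemma lienard_unique (h g u1 y1 u2 y2 : R -> R) (L : R) :
  0 <= L -> lipschitz L h -> lipschitz L g ->
  lienard h g u1 y1 -> lienard h g u2 y2 ->
  u1 0 = u2 0 -> y1 0 = y2 0 ->
  forall t, u1 t = u2 t /\ y1 t = y2 t.
Proof.
  intros hL hh hg s1 s2 eu ey t.
  assert ((u1 t - u2 t) ^ 2 + (y1 t - y2 t) ^ 2 = 0) as e.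
  { apply (gronwall_zero (fun t => (u1 t - u2 t) ^ 2 + (y1 t - y2 t) ^ 2)
      (fun t => 2 * (u1 t - u2 t) * (y1 t + h (u1 t) - (y2 t + h (u2 t)))
                + 2 * (y1 t - y2 t) * (- g (u1 t) + g (u2 t))) (1 + 3 * L)).
    - rewrite eu, ey. ring.
    - intro s. apply Rplus_le_le_0_compat; apply pow2_ge_0.
    - intro s. destruct (s1 s) as [a1 b1]. destruct (s2 s) as [a2 b2].
      auto_derive.
      + repeat split; eexists; eassumption.
      + rewrite (is_derive_unique (fun x : R => u1 x) s _ a1), (is_derive_unique (fun x : R => u2 x) s _ a2),
          (is_derive_unique (fun x : R => y1 x) s _ b1), (is_derive_unique (fun x : R => y2 x) s _ b2). ring.
    - intro s. specialize (hh (u1 s) (u2 s)). specialize (hg (u1 s) (u2 s)).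
      set (A := u1 s - u2 s) in *. set (B := y1 s - y2 s) in *.
      replace (y1 s + h (u1 s) - (y2 s + h (u2 s))) with (B + (h (u1 s) - h (u2 s)))
        by (unfold B; lra).
      replace (- g (u1 s) + g (u2 s)) with (- (g (u1 s) - g (u2 s))) by lra.
      set (H := h (u1 s) - h (u2 s)) in *. set (G := g (u1 s) - g (u2 s)) in *.
      eapply Rle_trans; [apply Rabs_triang |].
      rewrite !Rabs_mult, Rabs_Ropp, (Rabs_pos_eq 2) by lra.
      pose proof (Rabs_triang B H) as hBH.
      rewrite <- (pow2_abs A), <- (pow2_abs B).
      pose proof (Rabs_pos A). pose proof (Rabs_pos B).
      set (x := Rabs A) in *. set (z := Rabs B) in *.
      assert (2 * x * Rabs (B + H) <= 2 * x * (z + L * x)) by (apply Rmult_le_compat_l; lra).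
      assert (2 * z * Rabs G <= 2 * z * (L * x)) by (apply Rmult_le_compat_l; lra).
      (* Replacing [2 x z] by [x^2 + z^2] leaves [(1 + 3 L) x^2 + (1 + L) z^2], whence the constant
         [1 + 3 * L]. *)
      assert (0 <= (1 + L) * (x - z) ^ 2) by (apply Rmult_le_pos; [lra | apply pow2_ge_0]).
      assert (0 <= L * z ^ 2) by (apply Rmult_le_pos; [lra | apply pow2_ge_0]).
      nra. }
  rewrite <- !Rsqr_pow2 in e.
  apply Rplus_sqr_eq_0 in e. lra.
Qed.

(** * First zeros and the sign of a derivative at a zero *)

(** Take for [r] the supremum of the points up to which [f] stays negative; by continuity [f r] can
    be neither negative nor positive. *)
Lemma first_hitting (f : R -> R) (a b : R) :
  a <= b -> (forall x, a <= x <= b -> continuous f x) -> f a < 0 -> 0 <= f b ->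
  exists r, a < r <= b /\ f r = 0 /\ forall x, a <= x < r -> f x < 0.
Proof.
  intros hab hf ha hb.
  set (E := fun x => a <= x <= b /\ forall y, a <= y <= x -> f y < 0).
  destruct (completeness E) as [r [hub hlub]].
  - exists b. intros x hx. apply hx.
  - exists a. split; [lra |]. intros y hy. replace y with a by lra. exact ha.
  - assert (a <= r) as har.
    { apply hub. split; [lra |]. intros y hy. replace y with a by lra. exact ha. }
    assert (r <= b) as hrb by (apply hlub; intros x hx; apply hx).
    assert (forall x, a <= x < r -> f x < 0) as hneg.
    { intros x hx. apply Rnot_le_lt. intro hfx.
      assert (r <= x); [| lra].
      apply hlub. intros z [hz hz']. apply Rnot_lt_le. intro hxz.
      specialize (hz' x). lra. }
    pose proof (proj1 (continuous_eps _ _) (hf r (conj har hrb))) as hc.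
    destruct (Rtotal_order (f r) 0) as [h | [h | h]].
    + exfalso. destruct (hc (- f r)) as [d [hd hy]]; [lra |].
      assert (r <> b) by (intros ->; lra).
      set (r' := Rmin b (r + d / 2)).
      assert (r' <= b) by apply Rmin_l. assert (r' <= r + d / 2) by apply Rmin_r.
      assert (r < r') by (apply Rmin_glb_lt; lra).
      assert (r' <= r); [| lra].
      apply hub. split; [lra |]. intros y hy'.
      destruct (Rlt_dec y r); [apply hneg; lra |].
      specialize (hy y). rewrite Rabs_pos_eq in hy by lra.
      pose proof (Rle_abs (f y - f r)). lra.
    + exists r. split; [| split]; try assumption.
      split; [| assumption]. destruct har as [| <-]; [assumption | lra].
    + exfalso. destruct (hc (f r)) as [d [hd hy]]; [lra |].
      assert (r <> a) by (intros ->; lra).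
      set (x := Rmax a (r - d / 2)).
      assert (a <= x) by apply Rmax_l. assert (r - d / 2 <= x) by apply Rmax_r.
      assert (x < r) by (apply Rmax_lub_lt; lra).
      specialize (hneg x). specialize (hy x). rewrite Rabs_left in hy by lra.
      pose proof (Rcomplements.Rabs_maj2 (f x - f r)). lra.
Qed.

Lemma derive_neg_decreases (f : R -> R) (x d : R) :
  is_derive f x d -> d < 0 ->
  exists e, 0 < e /\ (forall y, x < y < x + e -> f y < f x) /\
                     (forall y, x - e < y < x -> f x < f y).
Proof.
  intros hf hd. apply is_derive_Reals in hf.
  destruct (hf (- d)) as [[e he] hy]; [lra |]. simpl in hy.
  exists e. split; [exact he |].
  assert (forall k, k <> 0 -> Rabs k < e -> (f (x + k) - f x) / k < 0) as hk.
  { intros k k0 hke. specialize (hy k k0 hke).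
    pose proof (Rle_abs ((f (x + k) - f x) / k - d)). lra. }
  split; intros y hxy.
  - specialize (hk (y - x)). rewrite Rabs_pos_eq in hk by lra.
    specialize (hk ltac:(lra) ltac:(lra)).
    replace (x + (y - x)) with y in hk by lra.
    apply Rlt_div_l in hk; lra.
  - specialize (hk (y - x)). rewrite Rabs_left in hk by lra.
    specialize (hk ltac:(lra) ltac:(lra)).
    replace (x + (y - x)) with y in hk by lra.
    apply Rnot_le_lt. intro h. 
    assert (0 <= (f y - f x) / (y - x)); [| lra].
    replace ((f y - f x) / (y - x)) with ((f x - f y) / (x - y)) by (field; lra).
    apply Rdiv_le_0_compat; lra.
Qed.

(** Zero can be crossed only downwards: at a first return to zero from below, the negative
    derivative would make [f] positive just before. *)
Lemma negative_after_zero (f df : R -> R) (a b : R) :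
  (forall x, a <= x <= b -> is_derive f x (df x)) ->
  (forall x, a <= x <= b -> f x = 0 -> df x < 0) ->
  f a <= 0 -> forall x, a < x <= b -> f x < 0.
Proof.
  intros hf hz ha x hx. apply Rnot_le_lt. intro hfx.
  assert (exists a', a <= a' < x /\ f a' < 0) as [a' [ha' hfa']].
  { destruct ha as [ha | ha]; [exists a; lra |].
    destruct (derive_neg_decreases f a (df a)) as [e [he [h _]]];
      [apply hf; lra | apply hz; lra |].
    set (y := Rmin ((a + x) / 2) (a + e / 2)).
    assert (y <= (a + x) / 2) by apply Rmin_l. assert (y <= a + e / 2) by apply Rmin_r.
    assert (a < y) by (apply Rmin_glb_lt; lra).
    exists y. split; [lra |]. rewrite <- ha. apply h. lra. }
  destruct (first_hitting f a' x) as [r [hr [hfr hneg]]]; try lra.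
  { intros y hy. eapply is_derive_continuous. apply hf. lra. }
  destruct (derive_neg_decreases f r (df r)) as [e [he [_ h]]];
    [apply hf; lra | apply hz; lra |].
  set (y := Rmax a' (r - e / 2)).
  assert (a' <= y) by apply Rmax_l. assert (r - e / 2 <= y) by apply Rmax_r.
  assert (y < r) by (apply Rmax_lub_lt; lra).
  specialize (hneg y). specialize (h y). lra.
Qed.

(** * Phase plane: energy, a priori bound and return to [u = 0] *)

(** The motion in the coordinates [u] and [w = u']. It is restricted to [[0, S]] because the
    truncated system is known to agree with it only while [u] stays in the truncation range. *)
Definition lienard_plane (g u w : R -> R) (S : R) : Prop :=
  forall t, 0 <= t <= S ->
    is_derive u t (w t) /\ is_derive w t (u t * w t - g (u t)).

(** Along the motion the energy has derivative [u * w^2]: the first-order term acts as negative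
    friction while [u >= 0]. *)
Lemma energy_nondecreasing (g G u w : R -> R) (S t : R) :
  (forall x, is_derive G x (g x)) ->
  lienard_plane g u w S -> (forall s, 0 <= s <= S -> 0 <= u s) ->
  u 0 = 0 -> w 0 = 1 -> G 0 = 0 ->
  0 <= t <= S -> 1 / 2 <= w t ^ 2 / 2 + G (u t).
Proof.
  intros hG huw hu u0 w0 G0 ht.
  replace (1 / 2) with (w 0 ^ 2 / 2 + G (u 0)) by (rewrite u0, w0, G0; lra).
  apply (nondecreasing_of_derive (fun s => w s ^ 2 / 2 + G (u s))
           (fun s => u s * w s ^ 2)); [lra | |].
  - intros s hs. destruct (huw s) as [hu' hw']; [lra |].
    auto_derive.
    + repeat split; eexists; eauto.
    + rewrite (is_derive_unique (fun x : R => u x) s _ hu'),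
        (is_derive_unique (fun x : R => w x) s _ hw'),
        (is_derive_unique (fun x : R => G x) (u s) _ (hG _)). field.
  - intros s hs. apply Rmult_le_pos; [apply hu; lra | apply pow2_ge_0].
Qed.

(* The function [V = ln z + (2/7) k^2 + (4/7) D / z], with [k = w / z], does
   not increase: [V' <= u * k * (1 - (4/7) * (k^2 - k + 2))], and
   [k^2 - k + 2 >= 7/4]. *)
Lemma ascent_bound (g u w : R -> R) (C r : R) :
  0 <= C -> lienard_plane g u w r -> u 0 = 0 -> w 0 = 1 -> 0 <= r ->
  (forall t, 0 <= t <= r -> 0 <= u t) ->
  (forall t, 0 <= t <= r -> 0 <= w t) ->
  (forall t, 0 <= t <= r -> u t * (u t ^ 2 - C) <= g (u t)) ->
  u r < 2 * exp (2 / 7 + 4 / 7 * (C + 2)).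
Proof.
  intros hC huw u0 w0 hr hu hw hg.
  set (z := fun t => u t ^ 2 / 2 + 1). set (D := C + 2).
  assert (forall t, 1 <= z t) as hz.
  { intro t. unfold z. pose proof (pow2_ge_0 (u t)). lra. }
  set (V := fun t => ln (z t) + 2 / 7 * (w t / z t) ^ 2 + 4 / 7 * D / z t).
  assert (V r <= V 0) as hV.
  { apply Ropp_le_cancel.
    apply (nondecreasing_of_derive (fun t => - V t) (fun t =>
      - (u t * w t / z t + 4 / 7 * (w t / z t)
           * (((u t * w t - g (u t)) * z t - w t * (u t * w t)) / z t ^ 2)
         - 4 / 7 * D * (u t * w t) / z t ^ 2))); [lra | |].
    - intros t ht. destruct (huw t) as [hu' hw']; [lra |]. specialize (hz t).
      unfold V, z in *. auto_derive.
      + repeat split; try (eexists; eassumption); lra.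
      + rewrite (is_derive_unique (fun x : R => u x) t _ hu'),
          (is_derive_unique (fun x : R => w x) t _ hw'). field. lra.
    - intros t ht. specialize (hz t). specialize (hu t ht). specialize (hw t ht).
      specialize (hg t ht).
      (* Since [u^2 = 2 z - 2], the lower bound on [g] gives, in the rescaled time [dtau = u dt],
         the inequality [z'' - z' + 2 z <= D]. *)
      assert (u t * w t - g (u t) <= u t * (w t - 2 * z t + D)) as h1.
      { unfold z, D. lra. }
      set (Z := z t) in *. set (k := w t / Z).
      assert (w t = k * Z) as ek by (unfold k; field; lra).
      assert (0 <= k) as hk by (apply Rdiv_le_0_compat; lra).
      clearbody k. rewrite ek in h1 |- *.
      assert (u t * (k * Z) / Z + 4 / 7 * k
           * (((u t * (k * Z) - g (u t)) * Z - k * Z * (u t * (k * Z))) / Z ^ 2)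
         - 4 / 7 * D * (u t * (k * Z)) / Z ^ 2 =
        u t * k + 4 / 7 * k * ((u t * (k * Z) - g (u t)) / Z - u t * k ^ 2)
          - 4 / 7 * D * u t * k / Z) as -> by (field; lra).
      assert ((u t * (k * Z) - g (u t)) / Z <= u t * (k - 2 + D / Z)) as h2.
      { apply Rle_div_l; [lra |]. eapply Rle_trans; [exact h1 |]. right. field. lra. }
      assert (4 / 7 * k * ((u t * (k * Z) - g (u t)) / Z - u t * k ^ 2)
              <= 4 / 7 * k * (u t * (k - 2 + D / Z) - u t * k ^ 2)) as h3.
      { apply Rmult_le_compat_l; lra. }
      (* This square is what remains: [(4/7) (k^2 - k + 2) = 1 + (4/7) (k - 1/2)^2], and the term
         [D / z] of [V] cancels the [D / Z] of [h2]. *)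
      assert (0 <= u t * k * (4 / 7 * (k - 1 / 2) ^ 2)) as h4.
      { apply Rmult_le_pos; [now apply Rmult_le_pos |].
        pose proof (pow2_ge_0 (k - 1 / 2)). lra. }
      unfold Rdiv in *. nra. }
  assert (V 0 = 2 / 7 + 4 / 7 * (C + 2)) as hV0.
  { unfold V, z, D. rewrite u0, w0. replace (0 ^ 2 / 2 + 1) with 1 by lra.
    rewrite ln_1. field. }
  assert (ln (z r) <= V 0) as hl.
  { eapply Rle_trans; [| exact hV]. unfold V. specialize (hz r).
    pose proof (pow2_ge_0 (w r / z r)).
    assert (0 <= 4 / 7 * D / z r); [| lra].
    apply Rdiv_le_0_compat; unfold D; lra. }
  apply exp_le in hl. rewrite exp_ln, hV0 in hl by (specialize (hz r); lra).
  set (e := exp _) in *. unfold z in hl.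
  apply Rnot_le_lt. intro h.
  assert (1 <= e) by (pose proof (pow2_ge_0 (u r)); lra). nra.
Qed.

(** At a zero of [w] the energy is [G (u t) >= 1/2], and the hypothesis comparing [G] with [g] makes
    [g (u t)] positive. *)
Lemma turns_downward (g G u w : R -> R) (M S t : R) :
  (forall x, is_derive G x (g x)) -> G 0 = 0 ->
  (forall x, 0 <= x <= M -> 0 < G x -> G x <= M * g x) ->
  lienard_plane g u w S -> u 0 = 0 -> w 0 = 1 ->
  (forall s, 0 <= s <= S -> 0 <= u s <= M) ->
  0 <= t <= S -> w t = 0 -> u t * w t - g (u t) < 0.
Proof.
  intros hG G0 hGg huw u0 w0 hu ht hw.
  assert (1 / 2 <= w t ^ 2 / 2 + G (u t)) as hE.
  { apply (energy_nondecreasing g G u w S); auto. intros s hs. now apply hu. }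
  rewrite hw in *. specialize (hu t ht). specialize (hGg (u t) hu). nra.
Qed.

(** [u] rises until the first zero of [w], where the ascent bound applies, and falls afterwards
    because [w] crosses zero only downwards. Improving [u <= M] to a strict inequality prepares a
    continuity argument. *)
Lemma orbit_bound (g G u w : R -> R) (C M S : R) :
  0 <= C -> M = 2 * exp (2 / 7 + 4 / 7 * (C + 2)) ->
  (forall x, is_derive G x (g x)) -> G 0 = 0 ->
  (forall x, 0 <= x <= M -> 0 < G x -> G x <= M * g x) ->
  (forall x, 0 <= x <= M -> x * (x ^ 2 - C) <= g x) ->
  lienard_plane g u w S -> u 0 = 0 -> w 0 = 1 ->
  (forall s, 0 <= s <= S -> 0 <= u s <= M) ->
  forall t, 0 <= t <= S -> u t < M.
Proof.
  intros hC hM hG G0 hGg hg huw u0 w0 hu t ht.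
  assert (forall r, 0 <= r <= t -> (forall s, 0 <= s <= r -> 0 <= w s) -> u r < M) as hup.
  { intros r hr hw. rewrite hM. apply (ascent_bound g u w C r); try lra; auto.
    - intros s hs. apply huw. lra.
    - intros s hs. apply hu. lra.
    - intros s hs. apply hg, hu. lra. }
  destruct (classic (exists s, 0 <= s <= t /\ w s <= 0)) as [[s [hs hws]] | hn].
  - destruct (first_hitting (fun x => - w x) 0 s) as [r [hr [hwr hpos]]]; try lra.
    { intros x hx. eapply is_derive_continuous.
      apply (is_derive_opp (V := R_NormedModule)). apply huw. lra. }
    assert (u r < M) as hur.
    { apply hup; [lra |]. intros x hx.
      destruct (Req_dec x r) as [-> | hxr]; [lra |]. specialize (hpos x). lra. }
    assert (forall x, r <= x <= t -> w x <= 0) as hneg.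
    { intros x hx. destruct (Req_dec x r) as [-> | hxr]; [lra |]. left.
      apply (negative_after_zero w (fun x => u x * w x - g (u x)) r t); try lra.
      - intros y hy. apply huw. lra.
      - intros y hy hy0. apply (turns_downward g G u w M S); auto. lra. }
    assert (- u r <= - u t); [| lra].
    apply (nondecreasing_of_derive (fun x => - u x) (fun x => - w x)); [lra | |].
    + intros x hx. apply (is_derive_opp (V := R_NormedModule)). apply huw. lra.
    + intros x hx. specialize (hneg x hx). lra.
  - apply hup; [lra |]. intros s hs. apply Rnot_lt_le. intro h.
    apply hn. exists s. lra.
Qed.

(* Along a monotone piece of the orbit, [w - u^2/2 -+ kap u] decreases at a
   definite rate: either [|w|] is bounded below, or the energy bound forces [g]
   to be. *)
Lemma monotone_orbit_escapes (g G u w : R -> R) (C M sg t1 : R) :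
  0 <= C -> 0 < M -> (sg = 1 \/ sg = -1) -> 0 <= t1 ->
  (forall x, is_derive G x (g x)) -> G 0 = 0 ->
  (forall x, 0 <= x <= M -> 0 < G x -> G x <= M * g x) ->
  (forall x, 0 <= x <= M -> x * (x ^ 2 - C) <= g x) ->
  (forall S, lienard_plane g u w S) -> u 0 = 0 -> w 0 = 1 ->
  (forall s, 0 <= s -> 0 <= u s <= M) ->
  ~ (forall t, t1 <= t -> 0 <= sg * w t).
Proof.
  intros hC hM hsg ht1 hG G0 hGg hg huw u0 w0 hu hw.
  (* If [G u > 1/4], then [g u >= G u / M] exceeds [c]. Otherwise the energy gives [|w| >= 1/2], and
     [kap / 2 = C * M + c] offsets the lower bound [- C * M] of [g]. *)
  set (c := / (4 * M)). set (kap := 2 * (C * M + c)).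
  assert (0 < c) as hc by (apply Rinv_0_lt_compat; lra).
  assert (c * M = / 4) as hcM by (unfold c; field; lra).
  assert (0 <= C * M) as hCM by (apply Rmult_le_pos; lra).
  assert (forall t, t1 <= t -> c <= g (u t) + kap * (sg * w t)) as hrate.
  { intros t ht. specialize (hw t ht).
    assert (1 / 2 <= w t ^ 2 / 2 + G (u t)) as hE.
    { apply (energy_nondecreasing g G u w t); auto; [| lra]. intros s hs. apply hu; lra. }
    assert (0 <= u t <= M) as hut by (apply hu; lra).
    destruct (Rle_dec (G (u t)) (1 / 4)) as [hle | hgt].
    - assert (1 / 2 <= sg * w t).
      { apply Rnot_lt_le. intro h.
        assert (w t ^ 2 = (sg * w t) ^ 2) as e by (destruct hsg as [-> | ->]; ring).
        nra. }
      specialize (hg (u t) hut).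
      assert (- (C * M) <= u t * (u t ^ 2 - C)).
      { assert (0 <= u t * u t ^ 2) by (apply Rmult_le_pos; [lra | apply pow2_ge_0]).
        nra. }
      unfold kap. nra.
    - specialize (hGg (u t) hut ltac:(lra)).
      assert (c <= g (u t)) by (apply Rnot_lt_le; intro h; nra).
      assert (0 <= kap * (sg * w t)); [| lra].
      apply Rmult_le_pos; [unfold kap; lra | exact hw]. }
  (* The term [u^2/2] cancels [u * w] in [w'], leaving [L' = - (g u + kap * sg * w)]. *)
  set (L := fun t => w t - u t ^ 2 / 2 - kap * sg * u t).
  assert (forall t, t1 <= t -> L t + c * t <= L t1 + c * t1) as hL.
  { intros t ht. apply Ropp_le_cancel.
    apply (nondecreasing_of_derive (fun s => - (L s + c * s))
             (fun s => g (u s) + kap * (sg * w s) - c)); [lra | |].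
    - intros s hs. destruct (huw s s) as [hu' hw']; [lra |].
      unfold L. auto_derive.
      + repeat split; eexists; eassumption.
      + rewrite (is_derive_unique (fun x : R => u x) s _ hu'),
          (is_derive_unique (fun x : R => w x) s _ hw'). field.
    - intros s hs. specialize (hrate s). lra. }
  set (B := L t1 + M ^ 2 + kap * M).
  assert (forall t, t1 <= t -> w t <= B - c * (t - t1)) as hwB.
  { intros t ht. specialize (hL t ht). unfold L in hL at 1.
    assert (0 <= u t <= M) as hut by (apply hu; lra).
    assert (u t ^ 2 <= M ^ 2) by (apply pow_incr; lra).
    pose proof (pow2_ge_0 (u t)).
    assert (0 <= kap) by (unfold kap; lra).
    assert (kap * sg * u t <= kap * M).
    { destruct hsg as [-> | ->]; nra. }
    unfold B. lra. }
  set (t2 := t1 + (Rabs B + 1) / c).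
  assert (0 <= (Rabs B + 1) / c) as ht2.
  { apply Rdiv_le_0_compat; [pose proof (Rabs_pos B); lra | lra]. }
  assert (forall t, t2 <= t -> w t <= -1) as hfast.
  { intros t ht. assert (t1 <= t) as ht' by (unfold t2 in ht; lra).
    specialize (hwB t ht').
    assert ((Rabs B + 1) / c <= t - t1) as h by (unfold t2 in ht; lra).
    apply Rle_div_l in h; [| lra]. pose proof (Rle_abs B). lra. }
  (* From [t2] on [u' <= -1], so [u] loses at least [M + 1] in time [M + 1], more than the interval
     [[0, M]] allows. *)
  assert (- (u t2 + t2) <= - (u (t2 + (M + 1)) + (t2 + (M + 1)))) as h.
  { apply (nondecreasing_of_derive (fun s => - (u s + s)) (fun s => - (w s + 1))); [lra | |].
    - intros s hs. destruct (huw s s) as [hu' hw']; [unfold t2 in *; lra |].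
      auto_derive; [eexists; eassumption |].
      rewrite (is_derive_unique (fun x : R => u x) s _ hu'). ring.
    - intros s hs. specialize (hfast s). lra. }
  pose proof (hu t2 ltac:(unfold t2; lra)).
  pose proof (hu (t2 + (M + 1)) ltac:(unfold t2; lra)). lra.
Qed.

(** Either [w] stays positive for ever, or it is nonpositive from some time on, as it crosses zero
    only downwards; a monotone orbit cannot stay bounded in either case. *)
Lemma orbit_returns (g G u w : R -> R) (C M : R) :
  0 <= C -> 0 < M ->
  (forall x, is_derive G x (g x)) -> G 0 = 0 ->
  (forall x, 0 <= x <= M -> 0 < G x -> G x <= M * g x) ->
  (forall x, 0 <= x <= M -> x * (x ^ 2 - C) <= g x) ->
  (forall S, lienard_plane g u w S) -> u 0 = 0 -> w 0 = 1 ->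
  ~ (forall s, 0 <= s -> 0 <= u s <= M).
Proof.
  intros hC hM hG G0 hGg hg huw u0 w0 hu.
  destruct (classic (exists s, 0 <= s /\ w s <= 0)) as [[s [hs hws]] | hn].
  - apply (monotone_orbit_escapes g G u w C M (-1) s); auto.
    intros t ht. destruct (Req_dec t s) as [-> | hts]; [lra |].
    assert (w t < 0); [| lra].
    apply (negative_after_zero w (fun x => u x * w x - g (u x)) s t); try lra.
    + intros y hy. apply (huw t). lra.
    + intros y hy hy0. apply (turns_downward g G u w M t); auto; try lra.
      intros r hr. apply hu. lra.
  - apply (monotone_orbit_escapes g G u w C M 1 0); auto; [lra |].
    intros t ht. apply Rnot_lt_le. intro h. apply hn. exists t. lra.
Qed.
(** A continuity argument: the plane equations are available only while [0 <= u <= M], but a first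
    time with [u = M] before the return to 0 would contradict the strict bound obtained there. *)
Lemma orbit_return_time (g G u w : R -> R) (C M : R) :
  0 <= C -> M = 2 * exp (2 / 7 + 4 / 7 * (C + 2)) ->
  (forall x, is_derive G x (g x)) -> G 0 = 0 ->
  (forall x, 0 <= x <= M -> 0 < G x -> G x <= M * g x) ->
  (forall x, 0 <= x <= M -> x * (x ^ 2 - C) <= g x) ->
  (forall t, continuous u t) -> is_derive u 0 (w 0) -> u 0 = 0 -> w 0 = 1 ->
  (forall S, (forall s, 0 <= s <= S -> 0 <= u s <= M) -> lienard_plane g u w S) ->
  exists T, 0 < T /\ u T = 0 /\ (forall t, 0 < t < T -> 0 < u t) /\
    forall t, 0 <= t <= T -> u t <= M.
Proof.
  intros hC hM hG G0 hGg hg huc hu0 u0 w0 huw.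
  assert (0 < M) as hM0 by (pose proof (exp_pos (2 / 7 + 4 / 7 * (C + 2))); lra).
  assert (forall S, (forall s, 0 < s <= S -> 0 < u s) ->
            forall t, 0 <= t <= S -> u t < M) as hbelow.
  { intros S hpos t ht. apply Rnot_le_lt. intro h.
    destruct (first_hitting (fun x => u x - M) 0 t) as [r [hr [hur hb]]]; try lra.
    { intros x _. apply (continuous_minus (V := R_NormedModule)); [apply huc |].
      apply continuous_const. }
    assert (forall s, 0 <= s <= r -> 0 <= u s <= M) as hs.
    { intros s hs. split.
      - destruct (Req_dec s 0) as [-> |]; [lra | left; apply hpos; lra].
      - destruct (Req_dec s r) as [-> |]; [lra |]. specialize (hb s). lra. }
    assert (u r < M); [| lra].
    apply (orbit_bound g G u w C M r); auto. lra. }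
  assert (exists e, 0 < e /\ forall t, 0 < t < e -> 0 < u t) as [e [he hstart]].
  { destruct (derive_neg_decreases (fun t => - u t) 0 (- w 0)) as [e [he [h _]]].
    - now apply (is_derive_opp (V := R_NormedModule)).
    - lra.
    - exists e. split; [exact he |]. intros t ht. specialize (h t). lra. }
  assert (exists t, 0 < t /\ u t <= 0) as [t [ht hut]].
  { apply NNPP. intro hn.
    assert (forall s, 0 < s -> 0 < u s) as hpos.
    { intros s hs. apply Rnot_le_lt. intro h. apply hn. now exists s. }
    assert (forall s, 0 <= s -> 0 <= u s <= M) as hall.
    { intros s hs. split.
      - destruct (Req_dec s 0) as [-> |]; [lra | left; apply hpos; lra].
      - left. apply (hbelow s); [intros r hr; apply hpos; lra | lra]. }
    apply (orbit_returns g G u w C M); auto.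
    intro S. apply huw. intros s hs. apply hall. lra. }
  assert (e <= t) as het.
  { apply Rnot_lt_le. intro h. specialize (hstart t). lra. }
  (* The search starts at [e / 2] because [u] also vanishes at 0. *)
  destruct (first_hitting (fun x => - u x) (e / 2) t) as [T [hT [huT hb]]]; try lra.
  { intros x _. now apply (continuous_opp (V := R_NormedModule)). }
  { specialize (hstart (e / 2)). lra. }
  assert (forall s, 0 < s < T -> 0 < u s) as hpos.
  { intros s hs. destruct (Rlt_dec s e); [apply hstart; lra |]. specialize (hb s). lra. }
  exists T. repeat split; try lra; [exact hpos |].
  intros s hs. destruct (Req_dec s T) as [-> |]; [lra | left].
  apply (hbelow s); [intros r hr; apply hpos; lra | lra].
Qed.

(** * The power nonlinearity and its truncation *)

Lemma abs_pow_pos_eq (a q : R) : 0 < a -> abs_pow a q = Rpower a q.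
Proof.
  intro ha. unfold abs_pow. destruct (Req_dec_T a 0); [lra |].
  now rewrite Rabs_pos_eq by lra.
Qed.

Lemma abs_pow_0 (q : R) : abs_pow 0 q = 0.
Proof. unfold abs_pow. destruct (Req_dec_T 0 0); [reflexivity | lra]. Qed.

Lemma abs_pow_opp (a q : R) : abs_pow (- a) q = abs_pow a q.
Proof.
  unfold abs_pow. rewrite Rabs_Ropp.
  destruct (Req_dec_T (- a) 0), (Req_dec_T a 0); try reflexivity; lra.
Qed.

Lemma abs_pow_nonneg (a q : R) : 0 <= abs_pow a q.
Proof.
  unfold abs_pow. destruct (Req_dec_T a 0); [lra | left; apply exp_pos].
Qed.

Lemma abs_pow_le (a b q : R) : 0 <= q -> 0 <= a <= b -> abs_pow a q <= abs_pow b q.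
Proof.
  intros hq hab. destruct (Req_dec a 0) as [-> |].
  - rewrite abs_pow_0. apply abs_pow_nonneg.
  - rewrite !abs_pow_pos_eq by lra. apply Rle_Rpower_l; lra.
Qed.

(** The condition [2 <= q], that is [p >= 3], makes the power dominate the square for [a > 1]; the
    [- 1] covers [a <= 1], where the left side is not positive. *)
Lemma sqr_minus_1_le_abs_pow (a q : R) : 2 <= q -> 0 <= a -> a ^ 2 - 1 <= abs_pow a q.
Proof.
  intros hq ha. destruct (Rle_dec a 1) as [h | h].
  - pose proof (abs_pow_nonneg a q). nra.
  - rewrite abs_pow_pos_eq by lra.
    assert (Rpower a 2 <= Rpower a q) as h2 by (apply Rle_Rpower; lra).
    replace (Rpower a 2) with (a ^ 2) in h2; [lra |].
    rewrite <- Rpower_pow by lra. reflexivity.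
Qed.

(** For positive arguments the derivative [(q + 1) s^q] is at most [(q + 1) M^q]. Oddness gives the
    negative ones, and opposite signs are compared through 0. The endpoint 0 is treated apart, as
    the derivative rule for [Rpower] is applied at a positive base. *)
Lemma mul_abs_pow_lipschitz (q M : R) (a b : R) :
  0 <= q -> Rabs a <= M -> Rabs b <= M ->
  Rabs (a * abs_pow a q - b * abs_pow b q)
    <= (q + 1) * abs_pow M q * Rabs (a - b).
Proof.
  intros hq.
  set (K := (q + 1) * abs_pow M q).
  assert (abs_pow M q <= K) as hMK.
  { unfold K. pose proof (abs_pow_nonneg M q). nra. }
  pose proof (abs_pow_nonneg M q) as hM.
  assert (forall a, 0 <= a <= M -> 0 <= a * abs_pow a q <= K * a) as hzero.
  { intros x hx. pose proof (abs_pow_nonneg x q).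
    pose proof (abs_pow_le x M q hq hx). split; nra. }
  assert (forall a b, 0 <= a <= b -> b <= M ->
    Rabs (b * abs_pow b q - a * abs_pow a q) <= K * (b - a)) as hpos.
  { intros x z hxz hz.
    pose proof (abs_pow_nonneg x q). pose proof (abs_pow_le x z q hq hxz).
    rewrite Rabs_pos_eq by nra.
    destruct (Req_dec x 0) as [-> |].
    { specialize (hzero z). lra. }
    assert (forall s, 0 < s -> s * abs_pow s q = Rpower s (q + 1)) as e.
    { intros s hs. rewrite abs_pow_pos_eq, Rpower_plus, Rpower_1 by exact hs. ring. }
    rewrite !e by lra.
    assert (K * x - Rpower x (q + 1) <= K * z - Rpower z (q + 1)); [| lra].
    apply (nondecreasing_of_derive (fun s => K * s - Rpower s (q + 1))
             (fun s => K - (q + 1) * Rpower s q)); [lra | |].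
    - intros s hs. apply (is_derive_minus (V := R_NormedModule)).
      + auto_derive; [trivial | ring].
      + apply is_derive_Reals. replace (Rpower s q) with (Rpower s (q + 1 - 1)) by (f_equal; lra).
        apply derivable_pt_lim_power. lra.
    - intros s hs. pose proof (abs_pow_le s M q hq ltac:(lra)) as h.
      rewrite abs_pow_pos_eq in h by lra. unfold K. nra. }
  assert (forall a b, a <= b -> Rabs a <= M -> Rabs b <= M ->
    Rabs (b * abs_pow b q - a * abs_pow a q) <= K * (b - a)) as hle.
  { intros x z hxz hx hz. apply Rabs_le_between in hx. apply Rabs_le_between in hz.
    destruct (Rle_dec 0 x) as [h0 | h0]; [apply hpos; lra |].
    destruct (Rle_dec z 0) as [h1 | h1].
    - specialize (hpos (- z) (- x) ltac:(lra) ltac:(lra)).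
      rewrite !abs_pow_opp in hpos.
      replace (z * abs_pow z q - x * abs_pow x q)
        with (- x * abs_pow x q - - z * abs_pow z q) by ring. lra.
    - pose proof (hzero z ltac:(lra)). pose proof (hzero (- x) ltac:(lra)) as h2.
      rewrite abs_pow_opp in h2. rewrite Rabs_pos_eq; lra. }
  intros ha hb. destruct (Rle_dec a b) as [h | h].
  - rewrite Rabs_minus_sym, (Rabs_minus_sym a b), (Rabs_pos_eq (b - a)) by lra. auto.
  - rewrite (Rabs_pos_eq (a - b)) by lra. apply hle; auto. lra.
Qed.

(** The interval is symmetric so that clipping is odd and the truncated field keeps the reflection
    symmetry. *)
Definition clip (M x : R) : R := Rmax (- M) (Rmin x M).

Lemma clip_id (M x : R) : - M <= x <= M -> clip M x = x.
Proof. intro h. unfold clip. rewrite Rmin_left by lra. apply Rmax_right. lra. Qed.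

Lemma Rabs_clip_le (M x : R) : 0 <= M -> Rabs (clip M x) <= M.
Proof.
  intro h. apply Rabs_le. unfold clip, Rmax, Rmin.
  destruct (Rle_dec x M), (Rle_dec _ _); lra.
Qed.

Lemma clip_opp (M x : R) : 0 <= M -> clip M (- x) = - clip M x.
Proof.
  intro h. unfold clip, Rmax, Rmin.
  destruct (Rle_dec (- x) M), (Rle_dec x M); repeat destruct (Rle_dec _ _); lra.
Qed.

Lemma clip_lipschitz (M : R) : lipschitz 1 (clip M).
Proof.
  intros a b. unfold clip, Rmax, Rmin.
  destruct (Rle_dec a M), (Rle_dec b M); repeat destruct (Rle_dec _ _);
    unfold Rabs; repeat destruct (Rcase_abs _); lra.
Qed.

(** * From the half orbit to a periodic solution *)

Lemma periodic_bound (u : R -> R) (T M : R) :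
  0 < T -> (forall t, u (t + 2 * T) = u t) ->
  (forall t, Rabs t <= T -> Rabs (u t) <= M) ->
  forall t, Rabs (u t) <= M.
Proof.
  intros hT hper hu.
  assert (forall n t, Rabs t <= (2 * INR n + 1) * T -> Rabs (u t) <= M) as h.
  { induction n as [| n IH]; intros t ht.
    - apply hu. simpl in ht. lra.
    - rewrite S_INR in ht. apply Rabs_le_between in ht. pose proof (pos_INR n).
      destruct (Rle_dec t (- T)); [| destruct (Rle_dec t T)].
      + rewrite <- hper. apply IH, Rabs_le. nra.
      + apply hu, Rabs_le. lra.
      + replace t with (t - 2 * T + 2 * T) by lra. rewrite hper. apply IH, Rabs_le. nra. }
  intro t. destruct (INR_unbounded (Rabs t / T)) as [n hn].
  apply (h n). apply Rlt_div_l in hn; [| exact hT].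
  pose proof (pos_INR n). nra.
Qed.

Theorem theorem2p5 (p lambda : R) (hp : 3 <= p) (hlambda : 0 < lambda) :
  exists u : R -> R, is_solution p lambda u /\ periodic u /\ sign_changing u.
Proof.
  set (q := p - 1). assert (2 <= q) as hq by (unfold q; lra).
  (* From [x^q >= x^2 - 1] follows [g x >= x * (x^2 - 1 - lambda)]. The bound [M] depends on [C]
     alone, so it can be fixed before truncating. *)
  set (C := 1 + lambda).
  set (M := 2 * exp (2 / 7 + 4 / 7 * (C + 2))).
  assert (0 < M) as hM by (unfold M; pose proof (exp_pos (2 / 7 + 4 / 7 * (C + 2))); lra).
  set (h := fun x => clip M x ^ 2 / 2).
  set (g := fun x => clip M x * abs_pow (clip M x) q - lambda * clip M x).
  set (K := (q + 1) * abs_pow M q).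
  assert (0 <= K) as hK by (unfold K; pose proof (abs_pow_nonneg M q); nra).
  set (L := M + K + lambda). assert (0 <= L) as hL by (unfold L; lra).
  assert (lipschitz L h) as hh.
  { intros a b. pose proof (clip_lipschitz M a b).
    pose proof (Rabs_clip_le M a ltac:(lra)) as ha.
    pose proof (Rabs_clip_le M b ltac:(lra)) as hb.
    unfold h. set (x := clip M a) in *. set (z := clip M b) in *.
    replace (x ^ 2 / 2 - z ^ 2 / 2) with ((x + z) / 2 * (x - z)) by field.
    rewrite Rabs_mult. apply Rmult_le_compat; try apply Rabs_pos; [| lra].
    apply Rabs_le. apply Rabs_le_between in ha. apply Rabs_le_between in hb.
    unfold L. lra. }
  assert (lipschitz L g) as hg.
  { intros a b. pose proof (clip_lipschitz M a b) as h1.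
    pose proof (mul_abs_pow_lipschitz q M (clip M a) (clip M b) ltac:(lra)
      (Rabs_clip_le M a ltac:(lra)) (Rabs_clip_le M b ltac:(lra))) as h2.
    fold K in h2. unfold g. set (x := clip M a) in *. set (z := clip M b) in *.
    match goal with |- Rabs ?e <= _ => replace e with
      ((x * abs_pow x q - z * abs_pow z q) + - (lambda * (x - z))) by ring end.
    eapply Rle_trans; [apply Rabs_triang |].
    rewrite Rabs_Ropp, Rabs_mult, (Rabs_pos_eq lambda) by lra.
    pose proof (Rabs_pos (a - b)).
    assert (K * Rabs (x - z) <= K * Rabs (a - b)) by (apply Rmult_le_compat_l; lra).
    assert (lambda * Rabs (x - z) <= lambda * Rabs (a - b)) by (apply Rmult_le_compat_l; lra).
    unfold L. nra. }
  assert (forall x, Rabs x <= M -> h x = x ^ 2 / 2) as h_eq.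
  { intros x hx. unfold h. rewrite clip_id; [reflexivity |]. now apply Rabs_le_between. }
  assert (forall x, Rabs x <= M -> g x = x * abs_pow x q - lambda * x) as g_eq.
  { intros x hx. unfold g. rewrite clip_id; [reflexivity |]. now apply Rabs_le_between. }
  assert (forall x, h (- x) = h x) as h_even.
  { intro x. unfold h. rewrite clip_opp by lra. field. }
  assert (forall x, g (- x) = - g x) as g_odd.
  { intro x. unfold g. rewrite clip_opp, abs_pow_opp by lra. ring. }
  assert (h 0 = 0) as h0 by (rewrite h_eq; [lra | rewrite Rabs_R0; lra]).
  assert (g 0 = 0) as g0 by (rewrite g_eq; [ring | rewrite Rabs_R0; lra]).
  pose proof (lipschitz_continuous L g hL hg) as hgc.
  set (G := fun x => RInt g 0 x).
  assert (forall x, is_derive G x (g x)) as hG by now apply is_derive_RInt_0.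
  assert (forall x, 0 <= x <= M -> 0 < G x -> G x <= M * g x) as hGg.
  { intros x hx hGx. set (m := Rmax (g x) 0).
    assert (0 * m - G 0 <= x * m - G x) as hle.
    { apply (nondecreasing_of_derive (fun s => s * m - G s) (fun s => m - g s)); [lra | |].
      - intros s _. apply (is_derive_minus (V := R_NormedModule)); [| apply hG].
        auto_derive; [trivial | ring].
      - intros s hs. unfold m.
        pose proof (Rmax_l (g x) 0). pose proof (Rmax_r (g x) 0).
        assert (g s <= 0 \/ g s <= g x); [| lra].
        rewrite !g_eq by (rewrite Rabs_pos_eq; lra).
        pose proof (abs_pow_le s x q ltac:(lra) hs).
        destruct (Rle_dec (abs_pow s q) lambda); [left | right]; nra. }
    unfold G at 1 in hle. rewrite RInt_0_0 in hle.
    assert (0 < m) as hm by nra.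
    assert (m = g x) as em.
    { unfold m, Rmax in *. destruct (Rle_dec (g x) 0); lra. }
    rewrite em in *. nra. }
  assert (forall x, 0 <= x <= M -> x * (x ^ 2 - C) <= g x) as hgC.
  { intros x hx. rewrite g_eq by (rewrite Rabs_pos_eq; lra).
    pose proof (sqr_minus_1_le_abs_pow x q hq ltac:(lra)). unfold C. nra. }
  destruct (lienard_exists h g L 1 hL hh hg h0 g0) as [u [y [u0 [y0 huy]]]].
  set (w := fun t => y t + u t ^ 2 / 2).
  assert (forall t, Rabs (u t) <= M ->
            is_derive u t (w t) /\ is_derive w t (u t * w t - g (u t))) as huw.
  { intros t ht. destruct (huy t) as [hu' hy']. rewrite h_eq in hu' by exact ht.
    split; [exact hu' |]. unfold w. auto_derive.
    - repeat split; eexists; eassumption.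
    - rewrite (is_derive_unique (fun x : R => u x) t _ hu'),
        (is_derive_unique (fun x : R => y x) t _ hy'). field. }
  destruct (orbit_return_time g G u w C M) as [T [hT [huT [hpos hle]]]]; auto.
  - unfold C; lra.
  - apply RInt_0_0.
  - intro t. eapply is_derive_continuous. apply huy.
  - apply huw. rewrite u0, Rabs_R0. lra.
  - unfold w. rewrite y0, u0. lra.
  - intros S hS t ht. apply huw. specialize (hS t ht). rewrite Rabs_pos_eq; lra.
  - assert (forall t, u t = - u (- t) /\ y t = y (- t)) as hsym.
    { apply (lienard_unique h g u y (fun t => - u (- t)) (fun t => y (- t)) L); auto.
      - intro t. destruct (huy (- t)) as [hu' hy']. split.
        + rewrite h_even. apply is_derive_reflect in hu'.
          apply (is_derive_opp (V := R_NormedModule)) in hu'.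
          eapply is_derive_eq; [exact hu' |]. unfold opp; simpl. ring.
        + rewrite g_odd. apply is_derive_reflect in hy'. exact hy'.
      - rewrite Ropp_0, u0. lra.
      - now rewrite Ropp_0. }
    assert (forall t, u (t + 2 * T) = u t) as hper.
    { assert (forall a, lienard h g (fun t => u (t + a)) (fun t => y (t + a))) as hshift.
      { intros a t. destruct (huy (t + a)) as [hu' hy']. split.
        - auto_derive; [eexists; exact hu' |].
          rewrite (is_derive_unique (fun x : R => u x) _ _ hu'). ring.
        - auto_derive; [eexists; exact hy' |].
          rewrite (is_derive_unique (fun x : R => y x) _ _ hy'). ring. }
      intro t.
      (* The orbits shifted by [T] and [- T] start at the same point: [u] vanishes at both times and
         [y] is even. *)
      destruct (lienard_unique h g _ _ _ _ L hL hh hg (hshift T) (hshift (- T)))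
        with (t := t + T) as [e _].
      - rewrite !Rplus_0_l. destruct (hsym T) as [e _]. lra.
      - rewrite !Rplus_0_l. apply hsym.
      - replace (t + T + T) with (t + 2 * T) in e by ring.
        replace (t + T + - T) with t in e by ring. exact e. }
    (* With this bound on the whole line the clipping is never active, so [u] solves the original
       equation. *)
    assert (forall t, Rabs (u t) <= M) as hbd.
    { apply (periodic_bound u T M); auto.
      assert (forall t, 0 <= t <= T -> Rabs (u t) <= M) as half.
      { intros t ht. rewrite Rabs_pos_eq; [auto |].
        destruct (Req_dec t 0) as [-> |]; [lra |].
        destruct (Req_dec t T) as [-> |]; [lra |]. left. apply hpos. lra. }
      intros t ht. destruct (hsym t) as [e _]. apply Rabs_le_between in ht.
      destruct (Rle_dec 0 t); [apply half; lra |].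
      rewrite e, Rabs_Ropp. apply half. lra. }
    assert (forall t, Derive u t = w t) as hD1.
    { intro t. apply is_derive_unique. now apply huw. }
    assert (forall t, is_derive (Derive u) t (u t * w t - g (u t))) as hD2'.
    { intro t. apply (is_derive_ext w); [now intro | now apply huw]. }
    assert (forall t, Derive (Derive u) t = u t * w t - g (u t)) as hD2.
    { intro t. now apply is_derive_unique. }
    assert (forall t, continuous u t) as huc.
    { intro t. eapply is_derive_continuous. apply huy. }
    assert (forall t, continuous w t) as hwc.
    { intro t. eapply is_derive_continuous. now apply huw. }
    exists u. split; [split | split].
    + intro t. split; [| split].
      * exists (w t). now apply huw.
      * exists (u t * w t - g (u t)). auto.
      * apply (continuous_ext (fun t => u t * w t - g (u t))); [now intro |].
        apply (continuous_minus (V := R_NormedModule)).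
        -- now apply (continuous_mult (K := R_AbsRing)).
        -- now apply (continuous_comp u g).
    + intro t. rewrite hD2, hD1, g_eq by apply hbd. fold q. ring.
    + exists (2 * T). split; [lra | exact hper].
    + split; [exists (T / 2) | exists (- (T / 2))].
      * apply hpos. lra.
      * destruct (hsym (- (T / 2))) as [e _]. rewrite Ropp_involutive in e.
        specialize (hpos (T / 2)). lra.
Qed.
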